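(* Let $K$ be a positive integer, let $P_X$ be an $n$-voter profile on a finite candidate set $X$, and let $x^*\in X$. Then $x^*$ is a possible cowinner for $P_X$ and $K$-approval with respect to the addition of one new candidate if and only if the following two conditions hold: 1. for every $x_i\in X$ with $x_i\neq x^*$, if $S_K(x_i,P_X)>S_K(x^*,P_X)$ then $n(P_X,K,x_i)\geq S_K(x_i,P_X)-S_K(x^*,P_X)$; 2. $S_K(x^*,P_X)\geq \sum_{x_i\in X}\max\bigl(0,\;S_K(x_i,P_X)-S_K(x^*,P_X)\bigr)$.
   Context: A vote over a finite candidate set $C$ is a linear order on $C$; an $n$-voter $C$-profile ($n\ge 1$) is a list $\langle V_1,\dots,V_n\rangle$ of votes over $C$. $n(P,i,x)$ denotes the number of votes in $P$ ranking $x$ in position $i$ (position 1 is the top), and $S_K(x,P)=\sum_{i=1}^K n(P,i,x)$ is the number of votes in $P$ ranking $x$ among the first $K$ positions. $K$-approval (the scoring rule with vector $\langle 1,\dots,1,0,\dots,0\rangle$ with $K$ ones, where $K$ is less than the number of candidates) is the correspondence $r_K$ mapping a profile $P$ to the set of candidates maximizing $S_K(\cdot,P)$; elements of $r_K(P)$ are called cowinners. If $X\subseteq C$, a $C$-profile $P'=\langle V_1',\dots,V_n'\rangle$ extends an $X$-profile $P_X=\langle V_1,\dots,V_n\rangle$ if for each $i$ the restriction of $V_i'$ to $X$ is $V_i$. A candidate $x^*\in X$ is a possible cowinner for $P_X$ and $r$ with respect to the addition of one new candidate if there is an $(X\cup\{y\})$-profile $P'$ extending $P_X$ with $x^*\in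 r(P')$, where $y\notin X$. *)

(* Defs.v *)
From mathcomp Require Export all_boot all_order all_algebra.

Set Implicit Arguments.
Unset Strict Implicit.
Unset Printing Implicit Defensive.

Definition linear_order (C : Type) (r : rel C) : Prop :=
  [/\ reflexive r, antisymmetric r, transitive r & total r].

(* [V x z] reads "V ranks x at least as high as z". *)
Record vote (C : finType) := Vote {
  vote_rel :> rel C;
  voteP : linear_order vote_rel
}.

Definition profile (C : finType) (n : nat) := n.-tuple (vote C).

(* Positions start at 1, the top: x itself is counted. *)
Definition position (C : finType) (V : vote C) (x : C) : nat :=
  #|[set z | V z x]|.

Definition nvotes (C : finType) (n : nat) (P : profile C n) (i : nat) (x : C)
    : nat :=
  count (fun V : vote C => position V x == i) P.

Definition score (C : finType) (n : nat) (K : nat) (x : C) (P : profile C n)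
    : nat :=
  \sum_(1 <= i < K.+1) nvotes P i x.

(* Only K < #|C| is meaningful as a scoring rule; this is not enforced here. *)
Definition approval (C : finType) (n : nat) (K : nat) (P : profile C n)
    : {set C} :=
  [set x | [forall z, score K z P <= score K x P]].

(* X is regarded as a subset of C through the inclusion map [incl]. *)
Definition extends (X C : finType) (incl : X -> C) (n : nat)
    (P' : profile C n) (P : profile X n) : Prop :=
  forall (i : 'I_n) (a b : X), tnth P' i (incl a) (incl b) = tnth P i a b.

(* X together with one new candidate y is [option X]: the old candidates are
   [Some x] and y is [None]. *)
Definition possible_cowinner_add1 (X : finType) (n : nat) (P : profile X n)
    (r : profile (option X) n -> {set option X}) (xs : X) : Prop :=
  exists P' : profile (option X) n, extends Some P' P /\ Some xs \in r P'.

(* Main.v *)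
(* In a vote of an extension, the new candidate y costs an old candidate x its
   point exactly when y lands among the first K and x was at position K. Since
   exactly one old candidate is at position K, only the set A of votes where y
   is among the first K matters: y scores #|A|, and each x loses the number m(x)
   of votes of A where x was at position K, with the m(x) summing to #|A|.
   Making x* a cowinner requires m(x) >= S(x) - S(x* ) for all x; conversely one
   takes A with m(x) = max(0, S(x) - S(x* )), which fits iff condition 1 holds,
   and y does not beat x* iff condition 2 holds. *)
Require Import Defs.
From mathcomp Require Import zify.
Import Order.TTheory GRing.Theory Num.Theory.
Local Open Scope ring_scope.

Set Implicit Arguments.
Unset Strict Implicit.

Lemma positionE (C : finType) (V : vote C) (x : C) :
  position V x = (\sum_z V z x)%N.
Proof.
rewrite /position -sum1_card big_mkcond /=.
by apply: eq_bigr => z _; rewrite inE; case: (V z x).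
Qed.

(** The sets counted by [position] are nested along the order. When [V x z] fails, [x] itself makes
    the inclusion strict. *)
Lemma position_le (C : finType) (V : vote C) (x z : C) :
  (position V x <= position V z)%N = V x z.
Proof.
have [refl anti trans tot] := voteP V.
have up a b : V a b -> [set w | V w a] \subset [set w | V w b].
  by move=> Vab; apply/subsetP => w; rewrite !inE => Vwa; apply: trans Vab.
apply/idP/idP => [|Vxz]; last exact/subset_leq_card/up.
apply: contraTT => nVxz; rewrite -ltnNge.
have Vzx : V z x by have := tot x z; rewrite (negPf nVxz).
apply/proper_card/properP; split; first exact: up.
by exists x; rewrite !inE ?refl.
Qed.

Lemma position_inj (C : finType) (V : vote C) : injective (position V).
Proof.
have [_ anti _ _] := voteP V.
by move=> x z e; apply: anti; rewrite -!position_le e leqnn.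
Qed.

Lemma position_gt0 (C : finType) (V : vote C) (x : C) : (0 < position V x)%N.
Proof.
have [refl _ _ _] := voteP V.
by apply/card_gt0P; exists x; rewrite inE refl.
Qed.

Lemma sum_position_eq (C : finType) (V : vote C) (k : nat) :
  (0 < k <= #|C|)%N -> (\sum_(x : C) (position V x == k) = 1)%N.
Proof.
move=> /andP[k_gt0 k_le].
(* Positions are injective and avoid 0, so by cardinality they fill all nonzero ordinals; hence some
   candidate sits at position [k]. *)
pose f x : 'I_#|C|.+1 := Ordinal (max_card [set z | V z x] : (_ < _.+1)%N).
have inj_f : injective f by move=> x z [] /position_inj.
have im_f : f @: [set: C] = [set~ ord0].
  apply/eqP; rewrite eqEcard card_imset // cardsT cardsC1 card_ord leqnn andbT.
  apply/subsetP => _ /imsetP[x _ ->]; rewrite !inE -val_eqE /= -lt0n.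
  exact: position_gt0.
have : (Ordinal (k_le : (k < #|C|.+1)%N) \in f @: [set: C]).
  by rewrite im_f !inE -val_eqE /= -lt0n.
case/imsetP => x _ [kE].
rewrite (bigD1 x) //= {1}/position kE eqxx big1 // => z zx.
by rewrite (inj_eq (@position_inj _ V)) (negPf zx).
Qed.

Lemma nvotesE (C : finType) (n : nat) (P : profile C n) (k : nat) (x : C) :
  nvotes P k x = #|[set i | position (tnth P i) x == k]|.
Proof.
by rewrite /nvotes -sum1_count big_tuple -sum1_card; apply: eq_bigl => i; rewrite inE.
Qed.

Lemma scoreE (C : finType) (n : nat) (K : nat) (x : C) (P : profile C n) :
  score K x P = (\sum_(i < n) (position (tnth P i) x <= K))%N.
Proof.
rewrite /score; elim: K => [|K IH].
  rewrite big_geq // big1 // => i _; apply/eqP.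
  by rewrite eqb0 -ltnNge position_gt0.
rewrite big_nat_recr //= IH nvotesE -sum1_card [X in (_ + X)%N]big_mkcond /=.
rewrite -big_split /=; apply: eq_bigr => i _; rewrite inE.
by case: eqP => [->|]; lia.
Qed.

Lemma sum_option (X : finType) (F : option X -> nat) :
  (\sum_u F u = F None + \sum_(x : X) F (Some x))%N.
Proof.
rewrite (bigD1 None) //= (reindex_omap Some id) => [|[]] //=.
by congr (_ + _)%N; apply: eq_bigl => x; rewrite eqxx.
Qed.

Section Restriction.
Variables (X : finType) (V' : vote (option X)) (V : vote X).
Hypothesis V'V : forall a b, V' (Some a) (Some b) = V a b.

Lemma position_Some x : position V' (Some x) = (V' None (Some x) + position V x)%N.
Proof.
rewrite !positionE sum_option; congr (_ + _)%N.
by apply: eq_bigr => a _; rewrite V'V.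
Qed.

(** Inserting y moves [x] down by at most one place, so only an [x] at position [K] can drop out.
    Since y and [x] are never tied, y is then above [x] exactly when y is among the first [K]. *)
Lemma approved_Some K x :
  ((position V' (Some x) <= K) +
   ((position V' None <= K) && (position V x == K)) = (position V x <= K))%N.
Proof.
have ne : position V' None <> position V' (Some x) by move/position_inj.
move: ne (position_le V' None (Some x)); rewrite position_Some.
by case: (V' None (Some x)) => /= ne leE; lia.
Qed.

End Restriction.

Section Insertion.
Variables (X : finType) (top : bool) (V : vote X).

(** Only whether y is among the first [K] matters, so it is enough to place y at the very top or the
    very bottom. *)
Definition insert_rel : rel (option X) := fun u v =>
  match u, v with
  | Some a, Some b => V a b
  | None, None => true
  | None, Some _ => top
  | Some _, None => ~~ top
  end.

Lemma insert_linear : linear_order insert_rel.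
Proof.
have [refl anti trans tot] := voteP V; split.
- by case.
- case=> [a|] [b|] //= => [/anti->//||]; by case: top.
- case=> [a|] [b|] [c|] //=; try (by case: top); exact: trans.
- by case=> [a|] [b|] //=; case: top.
Qed.

Definition insert : vote (option X) := Vote insert_linear.

Lemma position_insert_None : position insert None = if top then 1%N else #|X|.+1.
Proof.
rewrite positionE sum_option /= sum_nat_const.
by case: top; rewrite ?muln0 ?muln1.
Qed.

End Insertion.

(** This is m(x): the points that [x] loses when y is among the first [K] exactly in the votes of
    [A]. *)
Definition pushed (X : finType) (n K : nat) (P : profile X n) (A : {set 'I_n})
    (x : X) : nat :=
  #|[set i in A | position (tnth P i) x == K]|.

Definition top_voters (X : finType) (n K : nat) (P' : profile (option X) n) :
    {set 'I_n} :=
  [set i | position (tnth P' i) None <= K]%N.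

Lemma pushedE (X : finType) (n K : nat) (P : profile X n) (A : {set 'I_n}) (x : X) :
  pushed K P A x = (\sum_(i in A) (position (tnth P i) x == K))%N.
Proof.
rewrite /pushed -sum1_card [RHS]big_mkcond [LHS]big_mkcond /=.
by apply: eq_bigr => i _; rewrite !inE; case: (i \in A); case: (_ == K).
Qed.

(** Double counting: each vote of [A] has exactly one candidate at position [K]. *)
Lemma sum_pushed (X : finType) (n K : nat) (P : profile X n) (A : {set 'I_n}) :
  (0 < K <= #|X|)%N -> (\sum_(x : X) pushed K P A x = #|A|)%N.
Proof.
move=> hK; under eq_bigr => x _ do rewrite pushedE.
rewrite exchange_big /= -sum1_card; apply: eq_bigr => i _.
exact: sum_position_eq.
Qed.

Lemma score_None (X : finType) (n K : nat) (P' : profile (option X) n) :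
  score K None P' = #|top_voters K P'|.
Proof.
rewrite scoreE -sum1_card [RHS]big_mkcond /=.
by apply: eq_bigr => i _; rewrite inE; case: leqP.
Qed.

Lemma score_Some (X : finType) (n K : nat) (P : profile X n)
    (P' : profile (option X) n) (x : X) : extends Some P' P ->
  (score K (Some x) P' + pushed K P (top_voters K P') x = score K x P)%N.
Proof.
move=> ext; rewrite !scoreE pushedE [X in (_ + X)%N]big_mkcond /=.
rewrite -big_split /=; apply: eq_bigr => i _.
rewrite -(approved_Some (ext i) K x) inE.
by case: (position (tnth P' i) None <= K)%N.
Qed.

(** This replaces the extension by a set of votes. The first inequality says that y does not beat
    [xs], the second that no old candidate does; lost points are moved across to avoid truncated
    subtraction. *)
Lemma possible_cowinner_pushed (X : finType) (n K : nat) (P : profile X n) (xs : X) :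
  (0 < K <= #|X|)%N ->
  possible_cowinner_add1 P (approval K) xs <->
  exists A : {set 'I_n},
    (#|A| + pushed K P A xs <= score K xs P)%N /\
    forall x, (score K x P + pushed K P A xs <= score K xs P + pushed K P A x)%N.
Proof.
move=> hK; split=> [[P' [ext]]|[A [hA hx]]].
  rewrite inE => /forallP win; exists (top_voters K P').
  have sE x := score_Some K x ext.
  split=> [|x]; first by rewrite -(sE xs) leq_add2r -score_None; apply: win.
  by rewrite -(sE x) -(sE xs) [leqRHS]addnAC !leq_add2r; apply: win.
pose P' : profile (option X) n := [tuple insert (i \in A) (tnth P i) | i < n].
have ext : extends Some P' P by move=> i a b; rewrite tnth_mktuple.
(* The top place is position 1, at most [K], and the bottom place is [#|X|.+1], beyond [K]. *)
have topE : top_voters K P' = A.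
  apply/setP => i; rewrite inE tnth_mktuple position_insert_None.
  by have /andP[K_gt0 K_le] := hK; case: (i \in A) => //; rewrite ltnNge K_le.
have sE x : (score K (Some x) P' + pushed K P A x = score K x P)%N.
  by rewrite -{}topE score_Some.
exists P'; split=> //; rewrite inE; apply/forallP => -[x|].
  rewrite -(leq_add2r (pushed K P A x + pushed K P A xs)) addnA sE.
  by rewrite addnCA sE [leqRHS]addnC.
by rewrite score_None topE -(leq_add2r (pushed K P A xs)) sE.
Qed.

(** The sets [N x] of votes with [x] at position [K] are pairwise disjoint, so [d x] votes can be
    picked from each independently. *)
Lemma exists_pushed (X : finType) (n K : nat) (P : profile X n) (d : X -> nat) :
  (forall x, d x <= nvotes P K x)%N ->
  exists A : {set 'I_n}, forall x, pushed K P A x = d x.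
Proof.
move=> hd.
pose N x := [set i | position (tnth P i) x == K].
pose B x := [set i in take (d x) (enum (N x))].
have BN x i : i \in B x -> position (tnth P i) x == K.
  by rewrite inE => /mem_take; rewrite mem_enum inE.
exists (\bigcup_x B x) => x.
have -> : d x = #|B x|.
  rewrite cardsE (card_uniqP _) ?take_uniq ?enum_uniq //.
  by rewrite size_takel // -cardE -nvotesE.
congr #|pred_of_set _|; apply/setP => i; rewrite [LHS]inE.
apply/andP/idP => [[/bigcupP[z _ iBz] /eqP ix]|iBx].
  by have /eqP := BN z i iBz; rewrite -[RHS]ix => /position_inj <-.
by split; [apply/bigcupP; exists x | apply: BN].
Qed.

Unset Implicit Arguments.

Theorem proposition2 (X : finType) (n K : nat) (hn : (0 < n)%N) (hK : (0 < K)%N)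
    (hKC : (K < #|{: option X}|)%N) (P : profile X n) (xs : X) :
  possible_cowinner_add1 P (approval K) xs <->
  ((forall x : X, x <> xs -> (score K xs P < score K x P)%N ->
      (score K x P)%:Z - (score K xs P)%:Z <= (nvotes P K x)%:Z) /\
   \sum_(x : X) Num.max 0 ((score K x P)%:Z - (score K xs P)%:Z)
     <= (score K xs P)%:Z).
Proof.
have hKX : (0 < K <= #|X|)%N by rewrite card_option in hKC; rewrite hK.
(* Truncated subtraction on [nat] plays the role of the maximum with 0. *)
pose d x := (score K x P - score K xs P)%N.
have -> : \sum_(x : X) Num.max 0 ((score K x P)%:Z - (score K xs P)%:Z) =
          (\sum_(x : X) d x)%N%:Z.
  by rewrite (big_morph Posz PoszD (erefl _)); apply: eq_bigr => x _; rewrite /d; lia.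
rewrite lez_nat; split.
  move/(possible_cowinner_pushed _ _ hKX) => [A [hA hx]].
  have le_d x : (d x <= pushed K P A x)%N by have := hx x; rewrite /d; lia.
  split=> [x _ _|].
    have : (pushed K P A x <= nvotes P K x)%N.
      by rewrite nvotesE; apply/subset_leq_card/subsetP => i; rewrite !inE => /andP[].
    by have := le_d x; rewrite /d; lia.
  (* The deficits [d x] sum to at most [#|A|], which is the score of y and hence at most that of
     [xs]. *)
  apply: leq_trans (leq_sum _ (fun x _ => le_d x)) _.
  by rewrite sum_pushed //; lia.
case=> hd hsum; apply/(possible_cowinner_pushed _ _ hKX).
have [x|A pushed_d] := @exists_pushed X n K P d.
  have [lt_s|] := ltnP (score K xs P) (score K x P); last by rewrite /d; lia.
  have /hd/(_ lt_s) : x <> xs by move=> xE; rewrite xE ltnn in lt_s.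
  by rewrite /d; lia.
exists A; rewrite -(sum_pushed P A hKX).
under eq_bigr => x _ do rewrite pushed_d.
(* With this choice of [A], [xs] loses no point. *)
have dxs : d xs = 0%N by rewrite /d subnn.
split=> [|x]; rewrite !pushed_d dxs addn0 //.
by rewrite -leq_subLR.
Qed.
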